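(* The category $\mathbf{OGlSp}$ of ordered Gleason spaces (with strong meet-hemirelations satisfying the ordered forth condition and the de Vries condition as morphisms) and the category $\mathbf{PrFrm}$ of proximity frames (with proximity morphisms) are dual to each other, i.e. $\mathbf{OGlSp}$ is equivalent to the opposite category of $\mathbf{PrFrm}$.
   Context: **Proximity frames.** A frame is a complete lattice $L$ with $a\wedge\bigvee S=\bigvee\{a\wedge s\mid s\in S\}$ for all $a\in L$, $S\subseteq L$. A proximity frame is a pair $(L,\prec)$ with $L$ a frame and $\prec$ a binary relation on $L$ (a proximity relation) such that: (S1) $0\prec 0$ and $1\prec 1$; (S2) $a\prec b,c$ implies $a\prec b\wedge c$; (S3) $a,b\prec c$ implies $a\vee b\prec c$; (S4) $a\le b\prec c\le d$ implies $a\prec d$; (S5) $a=\bigvee\{b\in L\mid b\prec a\}$; (S6) $a\prec b$ implies $a\le b$; (S8) $a\prec b$ implies $a\prec c\prec b$ for some $c$. A proximity morphism is a map $h:L\to M$ between proximity frames such that: (H0) $h(1)=1$, $h(0)=0$ and $h(a\wedge b)=h(a)\wedge h(b)$; (H1) $a_1\prec b_1$ and $a_2\prec b_2$ imply $h(a_1\vee a_2)\prec h(b_1)\vee h(b_2)$; (H2) $h(a)=\bigvee\{h(b)\mid b\prec a\}$. The composition of proximity morphisms $h:L\to M$ and $g:M\to N$ is $(g\star h)(a)=\bigvee\{g(h(b))\mid b\prec a\}$. This gives the category $\mathbf{PrFrm}$. **Ordered Gleason spaces.** For a Priestley space $X$, $\mathrm{Clop}^{\uparrow}(X)$ denotes the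 lattice of clopen upsets ordered by inclusion, and $\mathrm{cl}$, $\mathrm{int}$ denote closure and interior. An f-space is a Priestley space in which the closure of every open upset is an open upset. For a relation $R\subseteq X\times Y$ and $E\subseteq Y$, $F\subseteq X$: $R[-,E]=\{x\mid\exists y\in E: x\mathrel R y\}$, $R[F,-]=\{y\mid\exists x\in F: x\mathrel R y\}$, with $R[x,-]=R[\{x\},-]$; $(\cdot)^c$ is the complement. An ordered Gleason space is a triple $(X,\le,R)$ where $(X,\le)$ is an f-space and $R$ is a binary relation on $X$ such that: (1) $R$ is closed in $X^2$; (2) $x\le y\mathrel R z\le t$ implies $x\mathrel R t$; (3) $R$ is a pre-order; (4) $O=\mathrm{cl}(R[-,O^c]^c)$ for every $O\in\mathrm{Clop}^{\uparrow}(X)$. On $\mathrm{Clop}^{\uparrow}(X)$ one puts the proximity relation $O\prec U$ iff $R[O,-]\subseteq U$. An element $x$ of a subset $S$ of an ordered Gleason space is $R$-minimal in $S$ if for every $y\in S$, $y\mathrel R x$ implies $x\mathrel R y$. **Morphisms.** A strong meet-hemirelation from $Y$ to $X$ (ordered Gleason spaces) is a relation $\rho\subseteq Y\times X$ such that: (1) $y_1\le y_2\mathrel\rho x_1\le x_2$ implies $y_1\mathrel\rho x_2$; (2) $\rho$ is closed in $Y\times X$; (3) $O\in\mathrm{Clop}^{\uparrow}(X)$ implies $\rho[-,O^c]^c\in\mathrm{Clop}^{\uparrow}(Y)$; (4) $\rho[y,-]\ne\emptyset$ for every $y\in Y$. - Ordered forth condition (ofc): for all $y_1,y_2\in Y$,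 every $x_1$ $R$-minimal in $\rho[y_1,-]$ and every $x_2\in X$, if $y_1\mathrel\rho x_1$, $y_1\mathrel R y_2$ and $y_2\mathrel\rho x_2$, then $x_1\mathrel R x_2$. - De Vries condition (dvc): $\rho[-,O^c]=\mathrm{int}(\rho[-,R[-,O^c]])$ for every $O\in\mathrm{Clop}^{\uparrow}(X)$. Meet-hemirelations $\rho\subseteq Y\times X$ correspond to meet-preserving maps $h:\mathrm{Clop}^{\uparrow}(X)\to\mathrm{Clop}^{\uparrow}(Y)$ via $h(O)=\rho[-,O^c]^c$ and, conversely, $y\mathrel\rho x$ iff for all $O\in\mathrm{Clop}^{\uparrow}(X)$, $y\in h(O)$ implies $x\in O$. If $\rho_1\subseteq Y\times X$ and $\rho_2\subseteq Z\times Y$ have associated maps $h_1,h_2$, the composition $\rho_1\star\rho_2\subseteq Z\times X$ is the relation associated to $h_2\star h_1$, where $(h_2\star h_1)(O)=\bigvee\{h_2(h_1(U))\mid U\prec O\}$. $\mathbf{OGlSp}$ is the category of ordered Gleason spaces with strong meet-hemirelations satisfying the ofc and the dvc, with this composition; the identity morphism of $(X,\le,R)$ is the relation $\le$. *)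

(* Defs.v *)
From HB Require Import structures.
From mathcomp Require Import all_boot all_order.
From mathcomp Require Import all_classical.
From mathcomp Require Import topology.

Set Implicit Arguments.
Unset Strict Implicit.
Unset Printing Implicit Defensive.

Import Order.TTheory.

Local Open Scope classical_set_scope.
Local Open Scope order_scope.

Local Obligation Tactic := idtac.

(** * Categories *)

Record category := Category {
  obj :> Type;
  hom : obj -> obj -> Type;
  idm : forall a, hom a a;
  compose : forall a b c, hom b c -> hom a b -> hom a c;
  comp1m : forall a b (f : hom a b), compose (idm b) f = f;
  compm1 : forall a b (f : hom a b), compose f (idm a) = f;
  compA : forall a b c d (f : hom a b) (g : hom b c) (k : hom c d),
    compose k (compose g f) = compose (compose k g) f }.

Arguments hom : clear implicits.
Arguments idm : clear implicits.

Definition opposite (C : category) : category :=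
  @Category C (fun a b => hom C b a) (idm C) (fun a b c f g => compose g f)
    (fun a b => @compm1 C b a) (fun a b => @comp1m C b a)
    (fun a b c d f g k => esym (compA k g f)).

Record functor (C D : category) := Functor {
  fobj :> C -> D;
  fhom : forall a b, hom C a b -> hom D (fobj a) (fobj b);
  fhom1 : forall a, fhom (idm C a) = idm D (fobj a);
  fhomM : forall a b c (g : hom C b c) (f : hom C a b),
    fhom (compose g f) = compose (fhom g) (fhom f) }.

Program Definition functor_id (C : category) : functor C C :=
  @Functor C C id (fun a b f => f) _ _.
Next Obligation. by []. Qed.
Next Obligation. by []. Qed.

Program Definition functor_comp (C D E : category)
    (G : functor D E) (F : functor C D) : functor C E :=
  @Functor C E (fun a => G (F a)) (fun a b f => fhom G (fhom F f)) _ _.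
Next Obligation. by move=> * /=; rewrite !fhom1. Qed.
Next Obligation. by move=> * /=; rewrite !fhomM. Qed.

Definition naturally_isomorphic (C D : category) (F G : functor C D) : Prop :=
  exists (eta : forall a, hom D (F a) (G a)) (eps : forall a, hom D (G a) (F a)),
    [/\ forall a b (f : hom C a b), compose (eta b) (fhom F f) = compose (fhom G f) (eta a),
        forall a, compose (eps a) (eta a) = idm D (F a) &
        forall a, compose (eta a) (eps a) = idm D (G a)].

Definition equivalent (C D : category) : Prop :=
  exists (F : functor C D) (G : functor D C),
    naturally_isomorphic (functor_comp G F) (functor_id C) /\
    naturally_isomorphic (functor_comp F G) (functor_id D).

(** Both categories below consist of maps or relations satisfying a predicate,
    with a composition that is defined on all maps or relations but is
    well-behaved only on those satisfying the predicate.  A [protocategory]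
    records these data; [is_category] says that the arrows satisfying the
    predicate form a category. *)

Record protocategory := Protocategory {
  pobj : Type;
  parrow : pobj -> pobj -> Type;
  is_hom : forall a b, parrow a b -> Prop;
  pid : forall a, parrow a a;
  pcomp : forall a b c, parrow b c -> parrow a b -> parrow a c }.

Arguments pid : clear implicits.

Record is_category (P : protocategory) : Prop := IsCategory {
  pid_hom : forall a, is_hom (pid P a);
  pcomp_hom : forall a b c (g : @parrow P b c) (f : @parrow P a b),
    is_hom g -> is_hom f -> is_hom (pcomp g f);
  pcomp1m : forall a b (f : @parrow P a b), is_hom f -> pcomp (pid P b) f = f;
  pcompm1 : forall a b (f : @parrow P a b), is_hom f -> pcomp f (pid P a) = f;
  pcompA : forall a b c d
    (f : @parrow P a b) (g : @parrow P b c) (k : @parrow P c d),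
    is_hom f -> is_hom g -> is_hom k ->
    pcomp k (pcomp g f) = pcomp (pcomp k g) f }.

Program Definition category_of (P : protocategory) (HP : is_category P) :
    category :=
  @Category (pobj P) (fun a b => {f : @parrow P a b | is_hom f})
    (fun a => exist _ (pid P a) (pid_hom HP a))
    (fun a b c g f => exist _ (pcomp (sval g) (sval f))
       (pcomp_hom HP (svalP g) (svalP f))) _ _ _.
Next Obligation. by move=> P HP a b [f hf]; apply: eq_exist; exact: pcomp1m. Qed.
Next Obligation. by move=> P HP a b [f hf]; apply: eq_exist; exact: pcompm1. Qed.
Next Obligation.
by move=> P HP a b c d [f hf] [g hg] [k hk]; apply: eq_exist; exact: pcompA.
Qed.

(** * Proximity frames *)

(** The least upper bound of [S] when it exists, in particular in complete
    lattices. *)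
Definition bigjoin d (L : tbLatticeType d) (S : set L) : L := supremum \bot S.

Definition is_frame d (L : tbLatticeType d) : Prop :=
  (forall S : set L, supremums S !=set0) /\
  (forall (a : L) (S : set L),
     a `&` bigjoin S = bigjoin [set a `&` s | s in S]).

Record is_proximity d (L : tbLatticeType d) (prec : L -> L -> Prop) : Prop := {
  prox_bot : prec \bot \bot;
  prox_top : prec \top \top;
  prox_meet : forall a b c, prec a b -> prec a c -> prec a (b `&` c);
  prox_join : forall a b c, prec a c -> prec b c -> prec (a `|` b) c;
  prox_trans : forall a b c d, a <= b -> prec b c -> c <= d -> prec a d;
  prox_approx : forall a, a = bigjoin [set b | prec b a];
  prox_le : forall a b, prec a b -> a <= b;
  prox_interp : forall a b, prec a b -> exists2 c, prec a c & prec c b }.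

Record proximity_frame := ProximityFrame {
  pf_disp : Order.disp_t;
  pf_lattice :> tbLatticeType pf_disp;
  prec : pf_lattice -> pf_lattice -> Prop;
  pf_frame : is_frame pf_lattice;
  pf_proximity : is_proximity prec }.

Notation "a ≺ b" := (prec a b) (at level 70, no associativity) : order_scope.

Record is_proximity_morphism (L M : proximity_frame) (h : L -> M) : Prop := {
  pm_top : h \top = \top;
  pm_bot : h \bot = \bot;
  pm_meet : forall a b, h (a `&` b) = h a `&` h b;
  pm_join : forall a1 b1 a2 b2 : L, a1 ≺ b1 -> a2 ≺ b2 ->
    h (a1 `|` a2) ≺ h b1 `|` h b2;
  pm_approx : forall a : L, h a = bigjoin [set h b | b in [set b | b ≺ a]] }.

Definition proximity_comp (L M N : proximity_frame) (g : M -> N) (h : L -> M) :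
    L -> N :=
  fun a => bigjoin [set g (h b) | b in [set b | b ≺ a]].

Definition PrFrm_data : protocategory :=
  @Protocategory proximity_frame (fun L M => L -> M)
    is_proximity_morphism (fun L => id) proximity_comp.

Section PrFrmCategory.

Lemma bigjoin_ub (L : proximity_frame) (S : set L) (a : L) :
  S a -> a <= bigjoin S.
Proof.
move=> Sa; rewrite /bigjoin /supremum; case: ifPn => [/eqP S0|_].
  by move: Sa; rewrite S0.
have [/(_ S) [x Sx] _] := pf_frame L.
by case: xgetP => [y _ [yS _]|/(_ x)//]; exact: yS.
Qed.

Lemma bigjoin_lub (L : proximity_frame) (S : set L) (b : L) :
  (forall a, S a -> a <= b) -> bigjoin S <= b.
Proof.
move=> Sb; rewrite /bigjoin /supremum; case: ifPn => [_|_]; first exact: le0x.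
have [/(_ S) [x Sx] _] := pf_frame L.
by case: xgetP => [y _ [_ /(_ b)]|/(_ x)//]; apply.
Qed.

Lemma pm_le (L M : proximity_frame) (h : L -> M) :
  is_proximity_morphism h -> forall a b, a <= b -> h a <= h b.
Proof. by move=> hh a b /meet_idPl ab; rewrite -ab (pm_meet hh) leIr. Qed.

Lemma pm_prec (L M : proximity_frame) (h : L -> M) (a b : L) :
  is_proximity_morphism h -> a ≺ b -> h a ≺ h b.
Proof. by move=> hh ab; have := pm_join hh ab ab; rewrite !joinxx. Qed.

Lemma proximity_comp_ge (L M N : proximity_frame) (g : M -> N) (h : L -> M)
  (a b : L) : b ≺ a -> g (h b) <= proximity_comp g h a.
Proof. by move=> ba; apply: bigjoin_ub; exists b. Qed.

Lemma proximity_comp_le (L M N : proximity_frame) (g : M -> N) (h : L -> M)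
  (a : L) (c : N) :
  (forall b, b ≺ a -> g (h b) <= c) -> proximity_comp g h a <= c.
Proof. by move=> H; apply: bigjoin_lub => _ [b ba <-]; exact: H. Qed.

Lemma proximity_comp_le_comp (L M N : proximity_frame) (g : M -> N)
  (h : L -> M) (a : L) : is_proximity_morphism g -> is_proximity_morphism h ->
  proximity_comp g h a <= g (h a).
Proof.
move=> gg hh; apply: proximity_comp_le => b ba.
by apply/(pm_le gg)/(pm_le hh)/(prox_le (pf_proximity L)).
Qed.

Lemma proximity_comp_hom (L M N : proximity_frame) (g : M -> N) (h : L -> M) :
  is_proximity_morphism g -> is_proximity_morphism h ->
  is_proximity_morphism (proximity_comp g h).
Proof.
move=> gg hh; have pL := pf_proximity L; have pN := pf_proximity N.
have mono a b : a <= b -> proximity_comp g h a <= proximity_comp g h b.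
  move=> ab; apply: proximity_comp_le => c ca; apply: proximity_comp_ge.
  exact: (prox_trans pL (lexx c) ca ab).
split.
- apply/eqP; rewrite -le1x; apply: le_trans (proximity_comp_ge _ _ (prox_top pL)).
  by rewrite (pm_top hh) (pm_top gg).
- apply/eqP; rewrite -lex0 -(pm_bot gg) -(pm_bot hh).
  exact: proximity_comp_le_comp.
- move=> a b; apply/eqP; rewrite eq_le lexI !mono ?leIl ?leIr//=.
  have [_ frm] := pf_frame N.
  rewrite [X in _ `&` X]/proximity_comp frm.
  apply: bigjoin_lub => _ [_ [d db <-] <-].
  rewrite meetC /proximity_comp frm; apply: bigjoin_lub => _ [_ [c ca <-] <-].
  rewrite -(pm_meet gg) -(pm_meet hh); apply: proximity_comp_ge.
  by apply: (prox_meet pL); [apply: (prox_trans pL _ ca (lexx _)); exact: leIr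
                            |apply: (prox_trans pL _ db (lexx _)); exact: leIl].
- move=> a1 b1 a2 b2 ab1 ab2.
  have [c1 ac1 cb1] := prox_interp pL ab1; have [c2 ac2 cb2] := prox_interp pL ab2.
  have [e1 ce1 eb1] := prox_interp pL cb1; have [e2 ce2 eb2] := prox_interp pL cb2.
  have ghce := pm_join gg (pm_prec hh ce1) (pm_prec hh ce2).
  apply: (prox_trans pN _ ghce).
    apply: le_trans (proximity_comp_le_comp _ gg hh) _; apply: (pm_le gg).
    exact: (prox_le (pf_proximity M) (pm_join hh ac1 ac2)).
  by rewrite leU2 // proximity_comp_ge.
- move=> a; apply/eqP; rewrite eq_le; apply/andP; split.
    apply: proximity_comp_le => b /(prox_interp pL)[c bc ca].
    apply: le_trans (proximity_comp_ge g h bc) _.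
    by apply: bigjoin_ub; exists c.
  apply: bigjoin_lub => _ [b ba <-]; apply: mono; exact: (prox_le pL ba).
Qed.

Lemma PrFrm_is_category : is_category PrFrm_data.
Proof.
split => /=.
- move=> L; have pL := pf_proximity L; split=> //.
    move=> a1 b1 a2 b2 ab1 ab2; apply: (prox_join pL).
      by apply: (prox_trans pL (lexx _) ab1); exact: leUl.
    by apply: (prox_trans pL (lexx _) ab2); exact: leUr.
  by move=> a; rewrite image_id; exact: (prox_approx pL).
- by move=> *; exact: proximity_comp_hom.
- by move=> L M h hh; apply/funext => a; rewrite [RHS](pm_approx hh).
- by move=> L M h hh; apply/funext => a; rewrite [RHS](pm_approx hh).
- move=> L M N K f g k ff gg kk; apply/funext => a.
  apply/eqP; rewrite eq_le; apply/andP; split.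
    apply: proximity_comp_le => b /(prox_interp (pf_proximity L))[c bc ca].
    apply: le_trans (proximity_comp_ge _ _ ca).
    apply: le_trans (proximity_comp_ge _ _ (pm_prec ff bc)).
    exact/(pm_le kk)/proximity_comp_le_comp.
  apply: proximity_comp_le => b /(prox_interp (pf_proximity L))[c bc ca].
  apply: le_trans (proximity_comp_ge _ _ ca).
  apply: le_trans (proximity_comp_le_comp _ kk gg) _; apply: (pm_le kk).
  exact: proximity_comp_ge.
Qed.

End PrFrmCategory.

Definition PrFrm : category := category_of PrFrm_is_category.

(** * Relations *)

(** [R[-, E]] *)
Definition rel_pre X Y (R : X -> Y -> Prop) (E : set Y) : set X :=
  [set x | exists2 y, E y & R x y].

(** [R[F, -]] *)
Definition rel_img X Y (R : X -> Y -> Prop) (F : set X) : set Y :=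
  [set y | exists2 x, F x & R x y].

Definition closed_rel (X Y : topologicalType) (R : X -> Y -> Prop) : Prop :=
  closed [set p : X * Y | R p.1 p.2].

Definition rel_minimal X (R : X -> X -> Prop) (S : set X) (x : X) : Prop :=
  S x /\ forall y, S y -> R y x -> R x y.

(** * Ordered Gleason spaces *)

Section Priestley.
Context {d : Order.disp_t} (X : POrderedTopological.type d).

Definition upset (A : set X) : Prop := forall x y, A x -> x <= y -> A y.

Definition priestley : Prop :=
  compact [set: X] /\
  forall x y : X, ~~ (x <= y) -> exists U : set X, [/\ clopen U, upset U, U x & ~ U y].

Definition f_space : Prop :=
  priestley /\
  forall U : set X, open U -> upset U -> open (closure U) /\ upset (closure U).

Definition is_clopup : pred (set X) := fun A => `[< clopen A /\ upset A >].

(** The lattice of clopen upsets, as a bounded sublattice of [set X]. *)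
Definition clopup := {A : set X | is_clopup A}.

Definition clopup_set (O : clopup) : set X := val O.

Lemma clopup_meet_closed : meet_closed is_clopup.
Proof.
move=> A B /asboolP[[oA cA] uA] /asboolP[[oB cB] uB]; apply/asboolP; split.
  by split; [exact: openI|exact: closedI].
by move=> x y [Ax Bx] xy; split; [exact: uA xy|exact: uB xy].
Qed.

Lemma clopup_join_closed : join_closed is_clopup.
Proof.
move=> A B /asboolP[[oA cA] uA] /asboolP[[oB cB] uB]; apply/asboolP; split.
  by split; [exact: openU|exact: closedU].
by move=> x y [Ax|Bx] xy; [left; exact: uA xy|right; exact: uB xy].
Qed.

Lemma clopup_bot : is_clopup \bot.
Proof. by apply/asboolP; split=> //; split; [exact: open0|exact: closed0]. Qed.

Lemma clopup_top : is_clopup \top.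
Proof. by apply/asboolP; split=> //; split; [exact: openT|exact: closedT]. Qed.

HB.instance Definition _ := Order.isMeetLatticeClosed.Build _ _ is_clopup
  clopup_meet_closed.
HB.instance Definition _ := Order.isJoinLatticeClosed.Build _ _ is_clopup
  clopup_join_closed.
HB.instance Definition _ := Order.isBLatticeClosed.Build _ _ is_clopup
  clopup_bot.
HB.instance Definition _ := Order.isTLatticeClosed.Build _ _ is_clopup
  clopup_top.
HB.instance Definition _ := SubChoice.on clopup.
HB.instance Definition _ :=
  [SubChoice_isTBSubLattice of clopup by <: with set_display].

End Priestley.

Coercion clopup_set : clopup >-> set.

Record is_ordered_gleason d (X : POrderedTopological.type d)
    (R : X -> X -> Prop) : Prop := {
  og_f_space : f_space X;
  og_closed : closed_rel R;
  og_le : forall x y z t : X, x <= y -> R y z -> z <= t -> R x t;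
  og_refl : forall x, R x x;
  og_trans : forall x y z, R x y -> R y z -> R x z;
  og_closure : forall O : clopup X, O = closure (~` rel_pre R (~` O)) :> set X }.

Record ordered_gleason_space := OrderedGleasonSpace {
  og_disp : Order.disp_t;
  og_space :> POrderedTopological.type og_disp;
  og_rel : og_space -> og_space -> Prop;
  og_axioms : is_ordered_gleason og_rel }.

Definition clopup_prec (X : ordered_gleason_space) (O U : clopup X) : Prop :=
  rel_img (@og_rel X) O `<=` U.

(** The map [O |-> ρ[-, O^c]^c] associated to [ρ]. *)
Definition map_of_rel (Y X : ordered_gleason_space) (rho : Y -> X -> Prop)
    (O : set X) : set Y := ~` rel_pre rho (~` O).

(** The relation associated to [h]. *)
Definition rel_of_map (Y X : ordered_gleason_space)
    (h : clopup X -> clopup Y) : Y -> X -> Prop :=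
  fun y x => forall O : clopup X, (h O : set Y) y -> (O : set X) x.

Record is_strong_hemirelation (Y X : ordered_gleason_space)
    (rho : Y -> X -> Prop) : Prop := {
  hr_le : forall (y1 y2 : Y) (x1 x2 : X),
    y1 <= y2 -> rho y2 x1 -> x1 <= x2 -> rho y1 x2;
  hr_closed : closed_rel rho;
  hr_clopup : forall O : clopup X, is_clopup (map_of_rel rho O);
  hr_strong : forall y : Y, rel_img rho [set y] !=set0 }.

Definition ordered_forth (Y X : ordered_gleason_space)
    (rho : Y -> X -> Prop) : Prop :=
  forall (y1 y2 : Y) (x1 x2 : X),
    rel_minimal (@og_rel X) (rel_img rho [set y1]) x1 ->
    rho y1 x1 -> og_rel y1 y2 -> rho y2 x2 -> og_rel x1 x2.

Definition de_vries (Y X : ordered_gleason_space)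
    (rho : Y -> X -> Prop) : Prop :=
  forall O : clopup X,
    rel_pre rho (~` O) =
    interior (rel_pre rho (rel_pre (@og_rel X) (~` O))).

Record is_OGlSp_morphism (Y X : ordered_gleason_space)
    (rho : Y -> X -> Prop) : Prop := {
  ogm_hemirelation : is_strong_hemirelation rho;
  ogm_forth : ordered_forth rho;
  ogm_de_vries : de_vries rho }.

(** For [rho1] from [Y] to [X] and [rho2] from [Z] to [Y], the relation
    associated to [O |-> ⋁ {h2 (h1 U) | U ≺ O}], the join being taken in the
    lattice of clopen upsets of [Z].  [h1] and [h2] are maps between powersets,
    so that this makes sense for arbitrary relations; when [rho1] and [rho2] are
    meet-hemirelations, every [h2 (h1 U)] is a clopen upset. *)
Definition hemirelation_comp (Z Y X : ordered_gleason_space)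
    (rho1 : Y -> X -> Prop) (rho2 : Z -> Y -> Prop) : Z -> X -> Prop :=
  rel_of_map (fun O : clopup X => bigjoin [set V : clopup Z |
    exists2 U : clopup X, clopup_prec U O &
      V = map_of_rel rho2 (map_of_rel rho1 U) :> set Z]).

(** That these data form a category is part of the duality theorem. *)
Definition OGlSp_data : protocategory :=
  @Protocategory ordered_gleason_space (fun Y X => Y -> X -> Prop)
    is_OGlSp_morphism (fun X x y => x <= y) hemirelation_comp.

(* Main.v *)
From HB Require Import structures.
From mathcomp Require Import all_boot all_order.
From mathcomp Require Import all_classical.
From mathcomp Require Import topology.
Require Import Defs.

(** A space [X] is sent to the proximity frame of its clopen upsets, and a
    morphism [rho] to [O |-> ρ[-, O^c]^c].  Priestley separation and compactness
    make this assignment bijective on hom-sets, with inverse [rel_of_map]: the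
    de Vries condition says exactly that the map is approximated from below,
    because [ρ[-, R[-, O^c]]^c] is the union of the [h U] for [U ≺ O] and joins
    are closures of unions; the ordered forth condition is equivalent to
    [h (a1 ∨ a2) ≺ h b1 ∨ h b2], because every nonempty closed set has an
    [R]-minimal element.  As the bijection carries the composition of relations
    to that of proximity morphisms, the category axioms transfer from PrFrm, and
    only essential surjectivity remains: a proximity frame is isomorphic to the
    clopen upsets of its space of prime filters, where [x R y] means that [a ≺ b]
    and [a ∈ x] imply [b ∈ y]. *)

Set Implicit Arguments.
Unset Strict Implicit.
Unset Printing Implicit Defensive.

Import Order.TTheory.

Local Open Scope order_scope.
Local Open Scope classical_set_scope.

(** * Priestley spaces *)

(** If no [f i] contains [K], the sets [K \ f i] generate a proper filter. A cluster point of it in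
    [K] would lie in some open [f i], which is disjoint from [K \ f i]. Directedness yields a single
    index in place of a finite subcover. *)
Lemma compact_directed_cover (T : topologicalType) (K : set T) I (P : set I)
    (f : I -> set T) :
  compact K -> P !=set0 -> (forall i, P i -> open (f i)) ->
  (forall i j, P i -> P j -> exists2 k, P k & f i `|` f j `<=` f k) ->
  K `<=` \bigcup_(i in P) f i -> exists2 i, P i & K `<=` f i.
Proof.
move=> cK [i0 Pi0] fo dir Kf; apply: contrapT => noi.
pose F := filter_from P (fun i => K `\` f i).
have FF : ProperFilter F.
  apply: filter_from_proper.
    apply: filter_from_filter; first by exists i0.
    move=> i j Pi Pj; have [k Pk fk] := dir _ _ Pi Pj; exists k => // x [Kx nfx].
    by split; split=> // fx; apply/nfx/fk; [left|right].
  move=> i Pi; apply: contrapT => K0; apply: noi; exists i => // x Kx.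
  by apply: contrapT => nfx; apply: K0; exists x.
have [|p [Kp clp]] := cK F FF; first by exists i0 => // x [].
have [i Pi fip] := Kf _ Kp.
have [||q [[_ nfq] fq]] := clp (K `\` f i) (f i); last exact: nfq.
- by exists i.
- by apply: open_nbhs_nbhs; split=> //; exact: fo.
Qed.

Section Priestley.
Context {d : Order.disp_t} (X : POrderedTopological.type d).

(** Clopen upsets form such a family, but so do the sets [basic_set a] in the
    prime filter spectrum, which are only later seen to be all clopen upsets. *)
Record priestley_base (B : set (set X)) : Prop := {
  pb_clopen : forall U, B U -> clopen U;
  pb_upset : forall U, B U -> upset U;
  pb0 : B set0;
  pbT : B setT;
  pbI : forall U V, B U -> B V -> B (U `&` V);
  pbU : forall U V, B U -> B V -> B (U `|` V);
  pb_sep : forall x y : X, ~~ (x <= y) -> exists U, [/\ B U, U x & ~ U y] }.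

Lemma priestley_sandwich (B : set (set X)) (K W : set X) :
  compact [set: X] -> priestley_base B ->
  closed K -> open W -> upset W -> K `<=` W ->
  exists U, [/\ B U, K `<=` U & U `<=` W].
Proof.
move=> cX pB clK oW uW KW.
have cpt (A : set X) : closed A -> compact A.
  by move=> cA; exact: subclosed_compact cA cX (@subsetT _ A).
(* Compactness is used twice: on [K], covered by the members of [B] inside [W], and, to see that
   they cover a given [x] in [K], on the complement of [W], covered by the complements of the
   members of [B] containing [x]. *)
have [||U V [BU UW] [BV VW]|x Kx|U [BU UW] KU] := @compact_directed_cover
  X K _ [set U | B U /\ U `<=` W] id (cpt _ clK).
- by exists set0; split; [exact: pb0|].
- by move=> U [BU _]; exact: (pb_clopen pB BU).1.
- exists (U `|` V) => //; split; first exact: pbU.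
  by move=> x [/UW|/VW].
- have [||U [BU Ux]|U V [BU Ux] [BV Vx]|y nWy|U [BU Ux] WU] :=
    @compact_directed_cover X (~` W) _ [set U | B U /\ U x] setC.
  + by apply: cpt; rewrite closedC.
  + by exists setT; split=> //; exact: pbT.
  + by rewrite openC; exact: (pb_clopen pB BU).2.
  + exists (U `&` V); last by rewrite setCI.
    by split=> //; exact: pbI.
  + have [|U [BU Ux nUy]] := @pb_sep _ pB x y; last by exists U.
    by apply/negP => xy; apply: nWy; exact: uW (KW _ Kx) xy.
  + by exists U => //; split=> //; rewrite -[U]setCK -[W]setCK; apply: subsetC.
- by exists U.
Qed.

Lemma clopup_clopen (O : clopup X) : clopen (O : set X).
Proof. by have /asboolP[] := valP O. Qed.

Lemma clopup_upset (O : clopup X) : upset (O : set X).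
Proof. by have /asboolP[] := valP O. Qed.

Lemma clopup_open (O : clopup X) : open (O : set X).
Proof. exact: (clopup_clopen O).1. Qed.

Lemma clopup_closed (O : clopup X) : closed (O : set X).
Proof. exact: (clopup_clopen O).2. Qed.

Definition mk_clopup (A : set X) (cA : clopen A) (uA : upset A) : clopup X :=
  exist (fun A => is_clopup A) A (asboolT (conj cA uA)).

Lemma clopup_ext (O U : clopup X) : O = U :> set X -> O = U.
Proof. exact: val_inj. Qed.

Lemma clopup_leP (O U : clopup X) : O <= U <-> (O : set X) `<=` U.
Proof. by split=> [/subsetPset|/subsetPset]. Qed.

Lemma clopup_meetE (O U : clopup X) : clopup_set (O `&` U)%O = O `&` U.
Proof. by []. Qed.

Lemma clopup_joinE (O U : clopup X) : clopup_set (O `|` U)%O = O `|` U.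
Proof. by []. Qed.

Hypothesis pX : priestley X.

Lemma clopup_base : priestley_base (range (@clopup_set d X)).
Proof.
split=> [_ [U _ <-]|_ [U _ <-]|||_ _ [U _ <-] [V _ <-]|_ _ [U _ <-] [V _ <-]|x y].
- exact: clopup_clopen.
- exact: clopup_upset.
- by exists \bot%O.
- by exists \top%O.
- by exists (U `&` V)%O.
- by exists (U `|` V)%O.
- move=> /(pX.2 _ _)[U [cU uU Ux Uy]]; exists U; split=> //.
  by exists (mk_clopup cU uU).
Qed.

Lemma clopup_sandwich (K W : set X) : closed K -> open W -> upset W -> K `<=` W ->
  exists2 U : clopup X, K `<=` U & (U : set X) `<=` W.
Proof.
move=> clK oW uW KW.
by have [_ [[U _ <-] KU UW]] := priestley_sandwich pX.1 clopup_base clK oW uW KW;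
  exists U.
Qed.

Lemma priestley_hausdorff : hausdorff_space X.
Proof.
have nb (U : set X) x : open U -> U x -> nbhs x U.
  by move=> oU Ux; apply: open_nbhs_nbhs.
move=> p q cl; apply/eqP; rewrite eq_le; apply/andP.
split; apply/negP => /negP /(pX.2 _ _)[U [[oU cU] _ Up nUq]].
  by have [||x [] //] := cl U (~` U); apply: nb => //; rewrite openC.
by have [||x [] //] := cl (~` U) U; apply: nb => //; rewrite openC.
Qed.

Lemma priestley_closed1 (x : X) : closed [set x].
Proof. exact: (compact_closed priestley_hausdorff (@compact_set1 _ x)). Qed.

Lemma open_upset_clopup (W : set X) (x : X) : open W -> upset W -> W x ->
  exists2 U : clopup X, (U : set X) x & (U : set X) `<=` W.
Proof.
move=> oW uW Wx.
have [_ -> //|U xU UW] := clopup_sandwich (@priestley_closed1 x) oW uW.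
by exists U => //; exact: xU.
Qed.

(** The points not below [x] form an open upset, by Priestley separation, and it contains [K]; the
    clopen upset is sandwiched between the two. *)
Lemma closed_upset_clopup (K : set X) (x : X) : closed K -> upset K -> ~ K x ->
  exists2 U : clopup X, K `<=` U & ~ (U : set X) x.
Proof.
move=> clK uK nKx.
have [|y z nyx yz|y Ky yx|U KU UW] :=
  @clopup_sandwich K [set y | ~ (y <= x)] clK.
- rewrite openE => y /= /negP /(pX.2 _ _)[U [[oU _] uU Uy nUx]].
  apply: (filterS _ (open_nbhs_nbhs (conj oU Uy))) => z Uz.
  by move=> zx; apply: nUx; exact: uU Uz zx.
- by move=> zx; apply: nyx; exact: le_trans zx.
- by apply: nKx; exact: uK Ky yx.
- by exists U => // /UW /=; apply; exact: lexx.
Qed.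

End Priestley.

(** * The proximity frame of an ordered Gleason space *)

Section FSpace.
Context {d : Order.disp_t} (X : POrderedTopological.type d).
Hypothesis fX : f_space X.

Lemma bigcup_clopup_open (S : set (clopup X)) :
  open (\bigcup_(U in S) clopup_set U).
Proof. by apply: bigcup_open => U _; exact: clopup_open. Qed.

Lemma bigcup_clopup_upset (S : set (clopup X)) :
  upset (\bigcup_(U in S) clopup_set U).
Proof. by move=> x y [U SU Ux] xy; exists U => //; exact: (clopup_upset Ux xy). Qed.

Definition clopup_sup (S : set (clopup X)) : clopup X :=
  let cl := fX.2 _ (bigcup_clopup_open S) (@bigcup_clopup_upset S) in
  mk_clopup (conj cl.1 (@closed_closure _ _)) cl.2.

Lemma clopup_supP (S : set (clopup X)) : supremums S (clopup_sup S).
Proof.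
split=> [U SU|V ubV]; apply/clopup_leP.
  by apply: subset_trans (@subset_closure _ _) => x Ux; exists U.
rewrite [X in _ `<=` X](closure_id _).1; last exact: clopup_closed.
by apply: closureS => x [U /ubV /clopup_leP]; apply.
Qed.

Lemma clopup_bigjoinE (S : set (clopup X)) :
  clopup_set (bigjoin S) = closure (\bigcup_(U in S) clopup_set U).
Proof.
suff -> : bigjoin S = clopup_sup S by [].
apply: (@is_subset1_supremums _ _ S); last exact: clopup_supP.
(* [bigjoin] is the default [\bot] on the empty set and a chosen supremum otherwise; in both cases
   it is a supremum, hence equal to [clopup_sup S]. *)
rewrite /bigjoin /supremum; case: ifPn => [/eqP ->|_].
  by split=> [x []|x _]; exact: le0x.
by case: xgetP => [y _|/(_ (clopup_sup S))/(_ (clopup_supP S))].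
Qed.

Lemma clopup_frame : is_frame (clopup X).
Proof.
split=> [S|a S]; first by exists (clopup_sup S); exact: clopup_supP.
apply: clopup_ext; rewrite clopup_meetE !clopup_bigjoinE.
apply/seteqP; split; last first.
  rewrite [X in X `&` _](closure_id _).1; last exact: clopup_closed.
  apply: subset_trans (@closureI _ _ _) => //.
  by apply: closureS => x [_ [U SU <-] [ax Ux]]; split=> //; exists U.
move=> x [ax clx] A Ax.
(* Since [a] is open, every neighbourhood [A] of [x] can be shrunk to [a ∩ A], so that the point
   found in the union also lies in [a]. *)
have [|y [[U SU Uy] [ay Ay]]] := clx (clopup_set a `&` A).
  by apply: filterI => //; apply: open_nbhs_nbhs; split=> //; exact: clopup_open.
by exists y; split=> //; exists (a `&` U)%O => //; exists U.
Qed.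

End FSpace.

(** * Closed relations between compact spaces *)

Section CompactRelations.
Context (X Y : topologicalType) (R : X -> Y -> Prop).
Hypotheses (cX : compact [set: X]) (cY : compact [set: Y]) (clR : closed_rel R).

Let compact_graph (A : set (X * Y)) : closed A ->
  compact ([set p | R p.1 p.2] `&` A).
Proof.
move=> clA; apply: (subclosed_compact _ (compact_setX cX cY)).
  exact: closedI.
by [].
Qed.

(** The preimage is the projection of a closed, hence compact, part of the graph, and compact sets
    are closed in a Hausdorff space. *)
Lemma closed_rel_pre (E : set Y) :
  hausdorff_space X -> closed E -> closed (rel_pre R E).
Proof.
move=> hX clE; apply: compact_closed => //.
have -> : rel_pre R E = fst @` ([set p | R p.1 p.2] `&` (snd @^-1` E)).
  apply/seteqP; split=> [x [y Ey xy]|_ [[x y] [/= xy Ey] <-]]; last by exists y.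
  by exists (x, y).
apply: continuous_compact.
  by apply: continuous_subspaceT => p; exact: cvg_fst.
apply: compact_graph; apply: preimage_closed => // p _; exact: cvg_snd.
Qed.

Lemma closed_rel_img (F : set X) :
  hausdorff_space Y -> closed F -> closed (rel_img R F).
Proof.
move=> hY clF; apply: compact_closed => //.
have -> : rel_img R F = snd @` ([set p | R p.1 p.2] `&` (fst @^-1` F)).
  apply/seteqP; split=> [y [x Fx xy]|_ [[x y] [/= xy Fx] <-]]; last by exists x.
  by exists (x, y).
apply: continuous_compact.
  by apply: continuous_subspaceT => p; exact: cvg_snd.
apply: compact_graph; apply: preimage_closed => // p _; exact: cvg_fst.
Qed.

End CompactRelations.

(** * The proximity on clopen upsets and [R]-minimal elements *)

Section Gleason.
Variable X : ordered_gleason_space.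
Local Notation R := (@og_rel X).
Let ogX := og_axioms X.
Let fX := og_f_space ogX.
Let pX := fX.1.
Let hX := priestley_hausdorff pX.

Lemma og_pre_closed (E : set X) : closed E -> closed (rel_pre R E).
Proof. by apply: closed_rel_pre hX; [exact: pX.1|exact: pX.1|exact: og_closed]. Qed.

Lemma og_img_closed (F : set X) : closed F -> closed (rel_img R F).
Proof. by apply: closed_rel_img hX; [exact: pX.1|exact: pX.1|exact: og_closed]. Qed.

Lemma og_pre_le (E : set X) (x y : X) : x <= y -> rel_pre R E y -> rel_pre R E x.
Proof. by move=> xy [z Ez yz]; exists z => //; exact: (og_le ogX xy yz (lexx _)). Qed.

Lemma og_img_upset (F : set X) : upset (rel_img R F).
Proof.
by move=> x y [z Fz zx] xy; exists z => //; exact: (og_le ogX (lexx _) zx xy).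
Qed.

Lemma og_box_open (O : clopup X) : open (~` rel_pre R (~` O)).
Proof.
by rewrite openC; apply: og_pre_closed; rewrite closedC; exact: clopup_open.
Qed.

Lemma og_box_upset (O : clopup X) : upset (~` rel_pre R (~` O)).
Proof. by move=> x y nx xy /(og_pre_le xy). Qed.

Lemma clopup_precP (O U : clopup X) :
  clopup_prec O U <-> (O : set X) `<=` ~` rel_pre R (~` U).
Proof.
split=> [OU x Ox [y nUy xy]|OU y [x Ox xy]]; first by apply/nUy/OU; exists x.
by apply: contrapT => nUy; apply: (OU _ Ox); exists y.
Qed.

(** The left side is an open upset, so it is the union of the clopen upsets inside it, and these are
    exactly the [U ≺ O]. This turns the closure axiom of an ordered Gleason space into approximation
    from below by [≺]. *)
Lemma og_boxE (O : clopup X) :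
  ~` rel_pre R (~` O) = \bigcup_(U in [set U | clopup_prec U O]) clopup_set U.
Proof.
apply/seteqP; split=> [x Wx|x [U /clopup_precP]]; last exact.
have [U Ux UW] :=
  open_upset_clopup pX (og_box_open O) (@og_box_upset O) Wx.
by exists U => //; exact/clopup_precP.
Qed.

Lemma clopup_proximity : is_proximity (@clopup_prec X).
Proof.
split.
- by move=> x [y []].
- by [].
- by move=> a b c ab ac x ax; split; [exact: ab|exact: ac].
- by move=> a b c ac bc x [y [ay|by_] yx]; [apply: ac|apply: bc]; exists y.
- move=> a b c e /clopup_leP ab bc /clopup_leP ce x [y /ab by_ yx].
  by apply/ce/bc; exists y.
- move=> O; apply: clopup_ext; rewrite (clopup_bigjoinE fX) -og_boxE.
  exact: (og_closure ogX).
- move=> a b ab; apply/clopup_leP => x ax; apply: ab; exists x => //.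
  exact: (og_refl ogX).
- move=> a b ab.
  (* Interpolation: transitivity of [R] puts the closed set [R[a,-]] inside the open upset
     [R[-,b^c]^c], and any clopen upset between them interpolates. *)
  have [|V KV VW] := clopup_sandwich pX (og_img_closed (@clopup_closed _ _ a))
      (og_box_open b) (@og_box_upset b).
    move=> y [x ax xy] [z nbz yz]; apply: nbz; apply: ab; exists x => //.
    exact: (og_trans ogX xy yz).
  by exists V => //; exact/clopup_precP.
Qed.

(** Zorn's lemma for the reverse of [R]. If a nonempty chain had no lower bound in [S], the open
    sets [R[-,s]^c] for [s] in the chain would cover [S]; by compactness one of them would contain
    [S], although [s R s]. *)
Lemma rel_minimal_exists (S : set X) : closed S -> S !=set0 ->
  exists x, rel_minimal R S x.
Proof.
move=> clS [x0 Sx0]; pose T := {x | S x}.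
pose r (s t : T) := `[< R (sval t) (sval s) >].
have cS : compact S by exact: (subclosed_compact clS pX.1 (@subsetT _ S)).
have [|t u s /asboolP rut /asboolP rsu|A tA|[x Sx] max] :=
  @ZL_preorder T (exist _ x0 Sx0) r.
- by move=> t; apply/asboolP; exact: (og_refl ogX).
- by apply/asboolP; exact: (og_trans ogX rsu rut).
- apply: contrapT => noub.
  have [A0|/set0P A0] := eqVneq A set0.
    by apply: noub; exists (exist _ x0 Sx0) => s; rewrite A0.
  have [||||[s Ss]] := @compact_directed_cover X S T A
    (fun s => ~` rel_pre R [set sval s]) cS => //.
  + move=> s As; rewrite openC; apply: og_pre_closed.
    exact: priestley_closed1.
  + have H (s t : T) : r s t ->
        ~` rel_pre R [set sval s] `<=` ~` rel_pre R [set sval t].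
      move=> /asboolP ts x nxs [_ -> xt]; apply: nxs; exists (sval s) => //.
      exact: (og_trans ogX xt ts).
    move=> s t As At; have [/H st|/H ts] := tA _ _ As At; [exists t|exists s] => //.
      by rewrite subUset; split.
    by rewrite subUset; split.
  + move=> x Sx; apply: contrapT => nx; apply: noub; exists (exist _ x Sx) => s As.
    apply/asboolP => /=; apply: contrapT => nxs; apply: nx; exists s => //.
    by move=> [_ -> ].
  + by move=> As /(_ s Ss); apply; exists s => //; exact: (og_refl ogX).
- exists x; split=> // y Sy yx.
  by have /asboolP := max (exist _ y Sy) (asboolT yx).
Qed.

End Gleason.

Definition clopup_pframe (X : ordered_gleason_space) : proximity_frame :=
  ProximityFrame (clopup_frame (og_f_space (og_axioms X))) (clopup_proximity X).

(** * Relations and proximity morphisms *)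

Section Hemirelations.
Variables Y X : ordered_gleason_space.
Let ogX := og_axioms X.
Let ogY := og_axioms Y.
Let fX := og_f_space ogX.
Let fY := og_f_space ogY.
Let pX := fX.1.
Implicit Types (rho : Y -> X -> Prop) (O U : clopup X).

(** The default value [\bot] is reached only when [rho] is not a
    meet-hemirelation. *)
Definition clopup_map rho (O : clopup_pframe X) : clopup_pframe Y :=
  insubd (\bot%O : clopup Y) (map_of_rel rho (clopup_set O)).

Lemma clopup_mapE rho O : is_strong_hemirelation rho ->
  clopup_set (clopup_map rho O) = map_of_rel rho O.
Proof. by move=> hr; rewrite /clopup_map /clopup_set insubdK //; exact: hr_clopup. Qed.

Lemma rel_img1 rho y : rel_img rho [set y] = rho y.
Proof. by apply/seteqP; split=> [x [_ ->]|x yx] //; exists y. Qed.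

Lemma map_of_relP rho (E : set X) y : map_of_rel rho E y <-> rho y `<=` E.
Proof.
split=> [ny x yx|yE [x nEx yx]]; last exact/nEx/yE.
by apply: contrapT => nEx; apply: ny; exists x.
Qed.

Lemma hr_section_closed rho y : is_strong_hemirelation rho -> closed (rho y).
Proof.
move=> hr; have -> : rho y = (fun x => (y, x)) @^-1` [set p | rho p.1 p.2] by [].
apply: preimage_closed; last exact: hr_closed.
move=> x _; apply: cvg_pair; [exact: cvg_cst|exact: cvg_id].
Qed.

Lemma hr_section_upset rho y : is_strong_hemirelation rho -> upset (rho y).
Proof. by move=> hr x x' yx xx'; apply: (hr_le hr (lexx y) yx xx'). Qed.

(** A point [y] is on the left iff the closed set [ρ[y,-]] lies in the open upset [R[-,O^c]^c]; a
    clopen upset [U] between them satisfies [U ≺ O] and has [y] in its image. *)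
Lemma hr_boxE rho O : is_strong_hemirelation rho ->
  ~` rel_pre rho (rel_pre (@og_rel X) (~` O)) =
  \bigcup_(U in [set clopup_map rho U | U in [set U | clopup_prec U O]]) clopup_set U.
Proof.
move=> hr; apply/seteqP; split=> [y ny|y [_ [U /clopup_precP UO <-]]]; last first.
  by rewrite clopup_mapE // => /map_of_relP yU [x Ox yx]; exact: UO (yU _ yx) Ox.
have [x yx|U yU UO] := clopup_sandwich pX (hr_section_closed (y := y) hr)
    (og_box_open O) (@og_box_upset _ O).
  by move=> Ox; apply: ny; exists x.
exists (clopup_map rho U); first by exists U => //; exact/clopup_precP.
by rewrite clopup_mapE //; apply/map_of_relP.
Qed.

Lemma de_vriesP rho : is_strong_hemirelation rho ->
  (de_vries rho <-> forall O : clopup_pframe X, clopup_map rho O =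
     bigjoin [set clopup_map rho U | U in [set U | U ≺ O]]).
Proof.
move=> hr; split=> dv O.
  apply: clopup_ext; rewrite (clopup_bigjoinE fY) -hr_boxE // closure_setC -dv.
  exact: clopup_mapE.
apply: setC_inj; rewrite -closure_setC hr_boxE // -(clopup_bigjoinE fY).
by rewrite -[RHS]/(clopup_set _) -dv clopup_mapE.
Qed.

Lemma clopup_map_hom rho : is_OGlSp_morphism rho ->
  is_proximity_morphism (clopup_map rho).
Proof.
move=> [hr fo /(de_vriesP hr) dv]; split=> //.
- by apply: clopup_ext; rewrite clopup_mapE //; apply/seteqP; split=> // y _ [x []].
- apply: clopup_ext; rewrite clopup_mapE //; apply/seteqP; split=> // y.
  move=> /map_of_relP y0; have [x] := hr_strong hr y; rewrite rel_img1.
  exact: y0.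
- move=> a b; apply: clopup_ext; rewrite clopup_meetE !clopup_mapE //.
  apply/seteqP; split=> y.
    by move=> /map_of_relP yab; split; apply/map_of_relP => x /yab[].
  by move=> [/map_of_relP ya /map_of_relP yb]; apply/map_of_relP => x yx; split;
    [exact: ya|exact: yb].
- move=> a1 b1 a2 b2 ab1 ab2; rewrite /prec /= => y2 [y1].
  rewrite clopup_joinE !clopup_mapE // => /map_of_relP y1a y12.
  (* Otherwise [ρ[y2,-]] has a point outside [b1] and a point outside [b2]. An [R]-minimal [x1] of
     [ρ[y1,-]] is [R]-below both by the forth condition, yet it lies in [a1] or in [a2]. *)
  apply: contrapT => /not_orP[].
  move=> /map_of_relP/existsNP[x2 /not_implyP[yx2 nx2]].
  move=> /map_of_relP/existsNP[x2' /not_implyP[yx2' nx2']].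
  have [|x1 x1min] := rel_minimal_exists (hr_section_closed (y := y1) hr).
    by have := hr_strong hr y1; rewrite rel_img1.
  have yx1 := x1min.1; rewrite -rel_img1 in x1min.
  have R12 := fo y1 y2 x1 _ x1min yx1 y12.
  have [ax1|ax1] := y1a _ yx1.
    by apply/nx2/ab1; exists x1 => //; exact: R12.
  by apply/nx2'/ab2; exists x1 => //; exact: R12.
Qed.

Section OfMap.
Variable h : clopup_pframe X -> clopup_pframe Y.
Hypothesis hh : is_proximity_morphism h.

(** If [ρ[y,-]] lies in [O], the complements of the [U] with [y ∈ h U] cover the complement of [O].
    They are directed because [h] preserves meets, so by compactness some such [U] lies in [O], and
    [y ∈ h O] by monotonicity. *)
Lemma rel_of_mapK O : map_of_rel (rel_of_map h) O = clopup_set (h O).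
Proof.
apply/seteqP; split=> [y|y hy [x nOx yx]]; last exact/nOx/yx.
move=> /map_of_relP yO.
have [|||U V hU hV|x nOx|U hU OU] := @compact_directed_cover X (~` O) _
    [set U : clopup X | clopup_set (h U) y] (fun U => ~` clopup_set U).
- apply: (subclosed_compact _ pX.1 (@subsetT _ _)).
  by rewrite closedC; exact: clopup_open.
- by exists (\top%O : clopup X); rewrite /= (pm_top hh).
- by move=> U _; rewrite openC; exact: clopup_closed.
- exists (U `&` V)%O; last by rewrite clopup_meetE setCI.
  by rewrite /= (pm_meet hh).
- apply: contrapT => nUx; apply/nOx/yO => U hU.
  by apply: contrapT => nUx'; apply: nUx; exists U.
- have /(pm_le hh)/clopup_leP : (U : clopup_pframe X) <= O.
    by apply/clopup_leP; rewrite -[U : set X]setCK -[O : set X]setCK; apply: subsetC.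
  exact.
Qed.

Let rho := rel_of_map h.

Lemma rel_of_map_strong : is_strong_hemirelation rho.
Proof.
split.
- move=> y1 y2 x1 x2 y12 r x12 O hO; apply: clopup_upset x12.
  by apply: r; exact: clopup_upset y12.
- rewrite /closed_rel -openC openE => -[y x] /= /existsNP[O /not_implyP[hO nO]].
  exists (clopup_set (h O), ~` clopup_set O) => /=.
    split; apply: open_nbhs_nbhs; split=> //; first exact: clopup_open.
    by rewrite openC; exact: clopup_closed.
  by move=> -[y' x'] [/= hy' nx'] /(_ O hy').
- by move=> O; rewrite rel_of_mapK; exact: valP.
- move=> y; apply: contrapT => y0.
  (* An empty [ρ[y,-]] is contained in the empty clopen upset, which would put [y] in [h \bot]. *)
  suff : clopup_set (h \bot%O) y by rewrite (pm_bot hh).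
  rewrite -rel_of_mapK; apply/map_of_relP => x yx; case: y0; exists x.
  by rewrite rel_img1.
Qed.

Lemma clopup_map_of : clopup_map rho = h.
Proof.
apply/funext => O; apply: clopup_ext.
by rewrite clopup_mapE ?rel_of_mapK //; exact: rel_of_map_strong.
Qed.

(** If [x1 R x2] fails, separate them by [x1 ∈ a1 ≺ b1 ≺ b] with [x2 ∉ b].  By
    minimality of [x1], the set [ρ[y1,-]] is covered by [a1] and the complement
    of [R[-,x1]], and by compactness by [a1] and some [a2 ≺ b2] with [x1 ∉ b2].
    Then [y1 ∈ h (a1 ∨ a2) <= h b1 ∨ h b2] forces [y1 ∈ h b1], so [y2 ∈ h b]
    and [x2 ∈ b]. *)
Lemma rel_of_map_forth : ordered_forth rho.
Proof.
move=> y1 y2 x1 x2; rewrite rel_img1 => -[_ x1min] yx1 y12 yx2.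
have hr := rel_of_map_strong.
have clx1 : closed [set x1] := @priestley_closed1 _ _ pX x1.
apply: contrapT => nx12.
have [|b x1b nbx2] := closed_upset_clopup pX (og_img_closed clx1)
    (@og_img_upset _ [set x1]) (_ : ~ rel_img (@og_rel X) [set x1] x2).
  by move=> [_ -> ].
have : (~` rel_pre (@og_rel X) (~` b)) x1.
  by move=> [z nbz x1z]; apply/nbz/x1b; exists x1.
rewrite og_boxE => -[a ab ax1].
have [b1 ab1 b1b] := prox_interp (clopup_proximity X) ab.
have [a1 aa1 ab1'] := prox_interp (clopup_proximity X) ab1.
pose W := ~` rel_pre (@og_rel X) [set x1].
have oW : open W by rewrite openC; exact: og_pre_closed.
have uW : upset W by move=> x y nx xy /(og_pre_le xy).
have sub : rho y1 `<=` clopup_set a1 `|` W.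
  move=> x yx; apply: contrapT => /not_orP[na1x /contrapT[_ -> xx1]].
  by apply/na1x/aa1; exists x1 => //; exact: x1min.
have [||O yO OaW] := clopup_sandwich pX (hr_section_closed (y := y1) hr) _ _ sub.
- by apply: openU => //; exact: clopup_open.
- by move=> x y [ax|Wx] xy; [left; exact: clopup_upset ax xy|right; exact: uW Wx xy].
have clOa : closed (clopup_set O `\` clopup_set a1).
  by apply: closedI; [exact: clopup_closed|rewrite closedC; exact: clopup_open].
have [|a2 Oa2 a2W] := clopup_sandwich pX clOa oW uW.
  by move=> x [/OaW[]].
have [|b2 a2b2 nb2x1] := closed_upset_clopup pX
    (og_img_closed (@clopup_closed _ _ a2)) (@og_img_upset _ a2)
    (_ : ~ rel_img (@og_rel X) a2 x1).
  by move=> [x /a2W nx xx1]; apply: nx; exists x1.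
have : clopup_set (h O) y1 by rewrite -rel_of_mapK; apply/map_of_relP.
have /(pm_le hh)/clopup_leP Oa : (O : clopup_pframe X) <= (a1 `|` a2)%O.
  apply/clopup_leP => x Ox; rewrite clopup_joinE.
  by have [|na1] := pselect (clopup_set a1 x); [left|right; exact: Oa2].
have /prox_le/clopup_leP := pm_join hh (ab1' : (a1 : clopup_pframe X) ≺ b1)
  (a2b2 : (a2 : clopup_pframe X) ≺ b2).
move=> /(_ (pf_proximity _)) H /Oa/H[hb1|/yx1 //].
apply/nbx2/yx2; apply: (pm_prec hh (b1b : (b1 : clopup_pframe X) ≺ b)).
by exists y1.
Qed.

Lemma rel_of_map_hom : is_OGlSp_morphism rho.
Proof.
split; [exact: rel_of_map_strong|exact: rel_of_map_forth|].
apply/(de_vriesP rel_of_map_strong); rewrite clopup_map_of.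
exact: (pm_approx hh).
Qed.

End OfMap.

(** The set [ρ[y,-]] is a closed upset, so it is the intersection of the clopen upsets containing
    it. *)
Lemma rel_of_clopup_map rho : is_strong_hemirelation rho ->
  rel_of_map (clopup_map rho) = rho.
Proof.
move=> hr; apply/funext => y; apply/funext => x; apply/propext; split; last first.
  by move=> yx O; rewrite clopup_mapE // => /map_of_relP; apply.
move=> H; apply: contrapT => nyx.
have [U yU] := closed_upset_clopup pX (hr_section_closed (y := y) hr)
  (@hr_section_upset _ y hr) nyx.
by apply; apply: H; rewrite clopup_mapE //; apply/map_of_relP.
Qed.

End Hemirelations.

(** * The category of ordered Gleason spaces *)

Lemma equivalent_of_fully_faithful (C D : category) (F : functor C D)
    (G : D -> C) (inv : forall a b, hom D (F a) (F b) -> hom C a b)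
    (eta : forall x, hom D (F (G x)) x) (eps : forall x, hom D x (F (G x))) :
  (forall a b, cancel (@fhom _ _ F a b) (@inv a b)) ->
  (forall a b, cancel (@inv a b) (@fhom _ _ F a b)) ->
  (forall x, compose (eps x) (eta x) = idm D (F (G x))) ->
  (forall x, compose (eta x) (eps x) = idm D x) ->
  equivalent C D.
Proof.
move=> FK invK epsK etaK.
have inj a b := can_inj (FK a b).
(* [G] is given on objects only; an arrow is conjugated by the isomorphisms and then pulled back
   along the full and faithful [F]. *)
pose Gh x y (f : hom D x y) := inv _ _ (compose (eps y) (compose f (eta x))).
have Gh1 x : Gh x x (idm D x) = idm C (G x).
  by apply: inj; rewrite invK fhom1 comp1m epsK.
have GhM x y z (g : hom D y z) (f : hom D x y) :
    Gh x z (compose g f) = compose (Gh y z g) (Gh x y f).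
  apply: inj; rewrite fhomM !invK -!compA; congr (compose _ _).
  by rewrite [in RHS](compA _ (eps y)) etaK comp1m.
exists F, (@Functor D C G Gh Gh1 GhM); split.
  exists (fun a => inv _ _ (eta (F a))), (fun a => inv _ _ (eps (F a))).
  split=> [a b f|a|a] /=; apply: inj; rewrite !fhomM !invK ?fhom1 //.
  by rewrite compA etaK comp1m.
exists eta, eps; split=> //= a b f.
by rewrite invK compA etaK comp1m.
Qed.

Lemma order_iso_proximity_morphism (L M : proximity_frame) (f : L -> M)
    (g : M -> L) : cancel f g -> cancel g f ->
  (forall a b, (f a <= f b) = (a <= b)) ->
  (forall a b, a ≺ b <-> f a ≺ f b) -> is_proximity_morphism f.
Proof.
move=> fK gK fle fprec; have pM := pf_proximity M.
have gfle a c : (a <= g c) = (f a <= c) by rewrite -fle gK.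
have fgle a c : (g c <= a) = (c <= f a) by rewrite -fle gK.
have fU a b : f (a `|` b)%O = (f a `|` f b)%O.
  apply/eqP; rewrite eq_le leUx !fle leUl leUr !andbT.
  by rewrite -gfle leUx !gfle leUl leUr.
split.
- by apply/eqP; rewrite -le1x -fgle lex1.
- by apply/eqP; rewrite -lex0 -gfle le0x.
- move=> a b; apply/eqP; rewrite eq_le lexI !fle leIl leIr /=.
  by rewrite -fgle lexI !fgle leIl leIr.
- move=> a1 b1 a2 b2 /fprec ab1 /fprec ab2; rewrite fU.
  apply: (prox_join pM).
    by apply: (prox_trans pM (lexx _) ab1); exact: leUl.
  by apply: (prox_trans pM (lexx _) ab2); exact: leUr.
- move=> a; rewrite [LHS](prox_approx pM); congr bigjoin.
  apply/seteqP; split=> [c ca|_ [b ba <-]]; last exact/fprec.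
  by exists (g c); rewrite ?gK //; apply/fprec; rewrite gK.
Qed.

(** Composition in PrFrm is not composition of functions, so inverse bijections need an argument:
    the composite at [a] is the join of all [b ≺ a], which is [a]. *)
Lemma proximity_comp_cancel (L M : proximity_frame) (f : L -> M) (g : M -> L) :
  cancel f g -> proximity_comp g f = id.
Proof.
move=> fK; apply/funext => a; rewrite [RHS](prox_approx (pf_proximity L)).
rewrite /proximity_comp; congr bigjoin.
by apply/seteqP; split=> [_ [b ba <-]|b ba]; [rewrite fK|exists b].
Qed.

Lemma hemirelation_compE (Z Y X : ordered_gleason_space)
    (rho1 : Y -> X -> Prop) (rho2 : Z -> Y -> Prop) :
  is_strong_hemirelation rho1 -> is_strong_hemirelation rho2 ->
  hemirelation_comp rho1 rho2 =
  rel_of_map (proximity_comp (clopup_map rho2) (clopup_map rho1)).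
Proof.
move=> hr1 hr2; rewrite /hemirelation_comp; congr rel_of_map.
apply/funext => O; congr bigjoin; apply/seteqP; split=> [V [U UO VE]|_ [U UO <-]].
  exists U => //; apply: clopup_ext.
  by rewrite VE !clopup_mapE.
by exists U => //; rewrite !clopup_mapE.
Qed.

Lemma rel_of_map_id (X : ordered_gleason_space) :
  rel_of_map (id : clopup_pframe X -> clopup_pframe X) = (fun x y : X => x <= y).
Proof.
apply/funext => x; apply/funext => y; apply/propext; split; last first.
  by move=> xy O; move/clopup_upset; apply.
move=> H; apply: contrapT => /negP /((og_f_space (og_axioms X)).1.2 _ _).
by move=> [U [cU uU Ux nUy]]; exact/nUy/(H (mk_clopup cU uU)).
Qed.

Lemma clopup_map_le (X : ordered_gleason_space) :
  clopup_map (fun x y : X => x <= y) = id.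
Proof.
rewrite -rel_of_map_id clopup_map_of //.
exact: (pid_hom PrFrm_is_category (clopup_pframe X)).
Qed.

Lemma le_OGlSp_morphism (X : ordered_gleason_space) :
  is_OGlSp_morphism (fun x y : X => x <= y).
Proof.
rewrite -rel_of_map_id; apply: rel_of_map_hom.
exact: (pid_hom PrFrm_is_category (clopup_pframe X)).
Qed.

Section Composition.
Variables (Z Y X : ordered_gleason_space).
Variables (r : Y -> X -> Prop) (s : Z -> Y -> Prop).
Hypotheses (hr : is_OGlSp_morphism r) (hs : is_OGlSp_morphism s).

Lemma hemirelation_comp_hom : is_OGlSp_morphism (hemirelation_comp r s).
Proof.
rewrite hemirelation_compE; [|exact: ogm_hemirelation..].
by apply/rel_of_map_hom/proximity_comp_hom; exact: clopup_map_hom.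
Qed.

Lemma clopup_map_comp : clopup_map (hemirelation_comp r s) =
  proximity_comp (clopup_map s) (clopup_map r).
Proof.
rewrite hemirelation_compE; [|exact: ogm_hemirelation..].
by rewrite clopup_map_of //; apply: proximity_comp_hom; exact: clopup_map_hom.
Qed.

End Composition.

Lemma clopup_map_inj (Y X : ordered_gleason_space) (r s : Y -> X -> Prop) :
  is_OGlSp_morphism r -> is_OGlSp_morphism s ->
  clopup_map r = clopup_map s -> r = s.
Proof.
move=> [hr _ _] [hs _ _] rs.
by rewrite -(rel_of_clopup_map hr) rs rel_of_clopup_map.
Qed.

Lemma OGlSp_is_category : is_category OGlSp_data.
Proof.
split => /=.
- exact: le_OGlSp_morphism.
- by move=> *; exact: hemirelation_comp_hom.
- move=> Y X r hr; have hl := le_OGlSp_morphism X.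
  apply: clopup_map_inj => //; first exact: hemirelation_comp_hom.
  rewrite clopup_map_comp // clopup_map_le.
  (* [clopup_map] reverses composition, so the left identity law for relations is the right identity
     law for maps. *)
  exact: (pcompm1 PrFrm_is_category (clopup_map_hom hr)).
- move=> Y X r hr; have hl := le_OGlSp_morphism Y.
  apply: clopup_map_inj => //; first exact: hemirelation_comp_hom.
  rewrite clopup_map_comp // clopup_map_le.
  exact: (pcomp1m PrFrm_is_category (clopup_map_hom hr)).
- move=> W Z Y X r s t hr hs ht.
  have rs := hemirelation_comp_hom hs hr; have st := hemirelation_comp_hom ht hs.
  apply: clopup_map_inj; [exact: hemirelation_comp_hom..|].
  rewrite !clopup_map_comp //.
  exact: (esym (pcompA PrFrm_is_category (clopup_map_hom ht) (clopup_map_hom hs)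
    (clopup_map_hom hr))).
Qed.

Definition OGlSp : category := category_of OGlSp_is_category.

Definition clopup_fhom (Y X : OGlSp) (r : hom OGlSp Y X) :
    hom (opposite PrFrm) (clopup_pframe Y) (clopup_pframe X) :=
  exist _ (clopup_map (sval r)) (clopup_map_hom (svalP r)).

Lemma clopup_fhom1 (X : OGlSp) :
  clopup_fhom (idm OGlSp X) = idm (opposite PrFrm) (clopup_pframe X).
Proof. by apply: eq_exist; exact: clopup_map_le. Qed.

Lemma clopup_fhomM (Z Y X : OGlSp) (r : hom OGlSp Y X) (s : hom OGlSp Z Y) :
  clopup_fhom (compose r s) =
  @compose (opposite PrFrm) _ _ _ (clopup_fhom r) (clopup_fhom s).
Proof.
by case: r s => [r hr] [s hs]; apply: eq_exist; exact: clopup_map_comp.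
Qed.

Definition clopup_functor : functor OGlSp (opposite PrFrm) :=
  @Functor OGlSp (opposite PrFrm) clopup_pframe clopup_fhom clopup_fhom1 clopup_fhomM.

Definition rel_of_map_fhom (Y X : OGlSp)
    (h : hom (opposite PrFrm) (clopup_functor Y) (clopup_functor X)) : hom OGlSp Y X :=
  exist _ (rel_of_map (sval h)) (rel_of_map_hom (svalP h)).

Lemma clopup_fhomK (Y X : OGlSp) :
  cancel (@clopup_fhom Y X) (@rel_of_map_fhom Y X).
Proof.
move=> [r hr]; apply: eq_exist => /=.
exact: rel_of_clopup_map (ogm_hemirelation hr).
Qed.

Lemma rel_of_map_fhomK (Y X : OGlSp) :
  cancel (@rel_of_map_fhom Y X) (@clopup_fhom Y X).
Proof. by move=> [h hh]; apply: eq_exist; exact: clopup_map_of. Qed.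

(** * The prime filter spectrum *)

Section PrimeFilters.
Variable L : proximity_frame.
Implicit Types (a b c : L) (F I : set L).

Lemma frame_meetU_le a b c : (a `&` (b `|` c) <= (a `&` b) `|` (a `&` c))%O.
Proof.
have bcE : (b `|` c <= bigjoin [set b; c])%O.
  by rewrite leUx !bigjoin_ub //; [right|left].
apply: le_trans (leI2 (lexx a) bcE) _; rewrite (pf_frame L).2.
by apply: bigjoin_lub => _ [_ [->|->] <-]; [exact: leUl|exact: leUr].
Qed.

Record is_filter F : Prop := {
  filter_top : F \top%O;
  filter_meet : forall a b, F a -> F b -> F (a `&` b)%O;
  filter_up : forall a b, F a -> a <= b -> F b }.

Record is_ideal I : Prop := {
  ideal_bot : I \bot%O;
  ideal_join : forall a b, I a -> I b -> I (a `|` b)%O;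
  ideal_down : forall a b, I b -> a <= b -> I a }.

Record is_prime_filter F : Prop := {
  prime_filter : is_filter F;
  prime_bot : ~ F \bot%O;
  prime_join : forall a b, F (a `|` b)%O -> F a \/ F b }.

(** The prime filter theorem: a filter maximal among those containing [F] and avoiding [I] is prime,
    by distributivity. *)
Lemma prime_filter_exists F I : is_filter F -> is_ideal I ->
  (forall a, F a -> ~ I a) ->
  exists A : set L, [/\ is_prime_filter A, F `<=` A & forall a, A a -> ~ I a].
Proof.
move=> fF iI FI.
(* [F] is required to be included only in nonempty [A], because the empty set, as the union of the
   empty chain, has to satisfy [P]. *)
pose P (A : set L) := [/\ forall a b, A a -> A b -> A (a `&` b)%O,
  forall a b, A a -> a <= b -> A b, forall a, A a -> ~ I a & A !=set0 -> F `<=` A].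
have PF : P F.
  by split=> // [a b|a b|_ a]; [exact: (filter_meet fF)|exact: (filter_up fF)|].
have [|A [[AI Aup AnI AF] maxA]] := @Zorn_bigcup L P.
  move=> C CP totC; split.
  - move=> a b [A CA Aa] [B CB Bb]; have [AB|BA] := totC _ _ CA CB.
      by exists B => //; have [BI _ _ _] := CP _ CB; apply: BI => //; exact: AB.
    by exists A => //; have [AI _ _ _] := CP _ CA; apply: AI => //; exact: BA.
  - move=> a b [A CA Aa] ab; exists A => //.
    by have [_ Aup _ _] := CP _ CA; exact: Aup ab.
  - by move=> a [A CA Aa]; have [_ _ AnI _] := CP _ CA; exact: AnI.
  - move=> [a [A CA Aa]] b Fb; exists A => //.
    by have [_ _ _ AF] := CP _ CA; apply: AF => //; exists a.
have A0 : A !=set0.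
  apply: contrapT => A0; apply: (maxA F) => //; split.
    by move=> a Aa; case: A0; exists a.
  by move=> /(_ \top%O (filter_top fF)) At; apply: A0; exists \top%O.
have {}AF := AF A0.
have fA : is_filter A by split=> //; exact/AF/(filter_top fF).
exists A; split=> //; split=> //; first by move=> /AnI; apply; exact: (ideal_bot iI).
(* By maximality, the filter generated by [A] and an [a] outside [A] meets [I]. *)
have ext a : ~ A a -> exists2 f, A f & I (f `&` a)%O.
  move=> nAa; apply: contrapT => nof.
  apply: (maxA [set c | exists2 f, A f & (f `&` a <= c)%O]).
    split; first by move=> c Ac; exists c => //; exact: leIl.
    move=> /(_ a); apply: contra_not nAa; apply.
    by exists \top%O; [exact/AF/(filter_top fF)|exact: leIr].
  split.
  - move=> c c' [f Af fc] [f' Af' fc']; exists (f `&` f')%O; first exact: AI.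
    rewrite lexI; apply/andP; split; [apply: le_trans fc|apply: le_trans fc'];
      by rewrite leI2 // ?leIl ?leIr.
  - by move=> c c' [f Af fc] cc'; exists f => //; exact: le_trans cc'.
  - by move=> c [f Af fc] Ic; apply: nof; exists f => //; exact: (ideal_down iI Ic fc).
  - move=> _ c Fc; exists c; [exact: AF|exact: leIl].
move=> a b Aab; apply: contrapT => /not_orP[/ext[f Af If] /ext[g Ag Ig]].
have Afg := AI _ _ Af Ag.
apply: (AnI _ (AI _ _ Afg Aab)); apply: (ideal_down iI (ideal_join iI If Ig)).
apply: le_trans (frame_meetU_le _ _ _) _.
by rewrite leU2 // leI2 // ?leIl ?leIr.
Qed.

End PrimeFilters.

Definition spectrum (L : proximity_frame) := {x : set L | is_prime_filter x}.

Definition basic_set (L : proximity_frame) (a : L) : set (spectrum L) :=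
  [set x | sval x a].

Section SpectrumStructure.
Variable L : proximity_frame.
Implicit Types x y z : spectrum L.

HB.instance Definition _ := gen_eqMixin (spectrum L).
HB.instance Definition _ := gen_choiceMixin (spectrum L).

Definition spectrum_le x y := `[< sval x `<=` sval y >].

Lemma spectrum_le_refl : reflexive spectrum_le.
Proof. by move=> x; apply/asboolP. Qed.

Lemma spectrum_le_anti : antisymmetric spectrum_le.
Proof.
move=> x y /andP[/asboolP xy /asboolP yx]; apply: eq_sig_hprop.
  by move=> ? ? ?; exact: Prop_irrelevance.
exact/seteqP.
Qed.

Lemma spectrum_le_trans : transitive spectrum_le.
Proof.
by move=> y x z /asboolP xy /asboolP yz; apply/asboolP; exact: subset_trans yz.
Qed.

HB.instance Definition _ := Order.Le_isPOrder.Build (pf_disp L) (spectrum L)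
  spectrum_le_refl spectrum_le_anti spectrum_le_trans.

(** The patch topology: the differences of basic sets form a base, which makes the basic sets
    clopen. *)
Definition spectrum_open (A : set (spectrum L)) : Prop :=
  forall x, A x -> exists a b : L,
    [/\ basic_set a x, ~ basic_set b x & basic_set a `\` basic_set b `<=` A].

Lemma spectrum_openT : spectrum_open setT.
Proof.
move=> x _; exists \top%O, \bot%O; split=> //.
  exact: filter_top (prime_filter (svalP x)).
exact: prime_bot (svalP x).
Qed.

Lemma spectrum_openI : setI_closed spectrum_open.
Proof.
move=> A B oA oB x [/oA[a [b [ax nbx abA]]] /oB[a' [b' [a'x nb'x abB]]]].
exists (a `&` a')%O, (b `|` b')%O; split.
- exact: filter_meet (prime_filter (svalP x)) _ _ ax a'x.
- by move=> /(prime_join (svalP x))[].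
move=> y [aay nbby]; have fy := prime_filter (svalP y); split.
  apply: abA; split; first exact: filter_up fy _ _ aay (leIl _ _).
  by move=> yb; apply: nbby; exact: filter_up fy _ _ yb (leUl _ _).
apply: abB; split; first exact: filter_up fy _ _ aay (leIr _ _).
by move=> yb; apply: nbby; exact: filter_up fy _ _ yb (leUr _ _).
Qed.

Lemma spectrum_open_bigU (I : Type) (f : I -> set (spectrum L)) :
  (forall i, spectrum_open (f i)) -> spectrum_open (\bigcup_i f i).
Proof.
move=> fo x [i _ /fo[a [b [ax nbx abf]]]]; exists a, b; split=> //.
by move=> y /abf; exists i.
Qed.

HB.instance Definition _ := isOpenTopological.Build (spectrum L)
  spectrum_openT spectrum_openI spectrum_open_bigU.

End SpectrumStructure.

(** * The spectrum as an ordered Gleason space *)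

Section Spectrum.
Variable L : proximity_frame.
Implicit Types (x y : spectrum L) (a b c : L).
Let pL := pf_proximity L.

Lemma spectrum_openE (A : set (spectrum L)) : open A = spectrum_open A.
Proof. by []. Qed.

Lemma spectrum_leP x y : x <= y <-> sval x `<=` sval y.
Proof. by split=> [/asboolP|xy]; last exact/asboolP. Qed.

Lemma basic_setT : basic_set (\top%O : L) = setT.
Proof. by apply/seteqP; split=> // x _; exact: filter_top (prime_filter (svalP x)). Qed.

Lemma basic_set0 : basic_set (\bot%O : L) = set0.
Proof. by apply/seteqP; split=> // x; exact: prime_bot (svalP x). Qed.

Lemma basic_setI a b : basic_set (a `&` b)%O = basic_set a `&` basic_set b.
Proof.
apply/seteqP; split=> x; have fx := prime_filter (svalP x).
  by move=> xab; split; apply: (filter_up fx xab); [exact: leIl|exact: leIr].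
by move=> [xa xb]; exact: (filter_meet fx xa xb).
Qed.

Lemma basic_setU a b : basic_set (a `|` b)%O = basic_set a `|` basic_set b.
Proof.
apply/seteqP; split=> x; first exact: (prime_join (svalP x)).
have fx := prime_filter (svalP x).
by move=> [xa|xb]; [apply: (filter_up fx xa)|apply: (filter_up fx xb)];
  [exact: leUl|exact: leUr].
Qed.

Lemma basic_set_clopen a : clopen (basic_set a).
Proof.
split; first rewrite spectrum_openE.
  move=> x ax; exists a, \bot%O; rewrite basic_set0 setD0.
  by split=> //; exact: ax.
rewrite -openC spectrum_openE => x nax; exists \top%O, a; rewrite basic_setT setTD.
by split.
Qed.

Lemma basic_set_upset a : upset (basic_set a).
Proof. by move=> x y ax /spectrum_leP; apply. Qed.

Definition basic_clopup a : clopup (spectrum L) :=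
  mk_clopup (basic_set_clopen a) (@basic_set_upset a).

(** If [a <= b] fails, the principal filter of [a] misses the principal ideal of [b], and a prime
    filter separates them. *)
Lemma basic_set_le a b : basic_set a `<=` basic_set b <-> a <= b.
Proof.
split=> [ab|ab x xa]; last exact: (filter_up (prime_filter (svalP x)) xa ab).
apply: contrapT => nab.
have [|||A [pA aA Ab]] := @prime_filter_exists L [set c | a <= c] [set c | c <= b].
- split=> /=; first exact: lex1.
    by move=> c e ac ae; rewrite lexI ac.
  by move=> c e ac ce; exact: le_trans ce.
- split=> /=; first exact: le0x.
    by move=> c e cb eb; rewrite leUx cb.
  by move=> c e eb ce; exact: le_trans eb.
- by move=> c ac cb; exact/nab/(le_trans ac cb).
- have := ab (exist _ A pA) (aA _ (lexx a)).
  by move=> /Ab; apply; exact: lexx.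
Qed.

Lemma spectrum_compact : compact [set: spectrum L].
Proof.
rewrite compact_ultra => F uF _; have pF : ProperFilter F := ultra_proper.
(* This is the limit of the ultrafilter [F]; it is prime because [F] contains each set or its
   complement. *)
pose A := [set a : L | F (basic_set a)].
have pA : is_prime_filter A.
  split.
  - split=> [|a b|a b]; rewrite /A /=.
    + by rewrite basic_setT; exact: filterT.
    + by rewrite basic_setI; exact: filterI.
    + by move=> Fa ab; apply: filterS Fa; exact/basic_set_le.
  - by rewrite /A /= basic_set0; exact: filter_not_empty.
  - move=> a b; rewrite /A /= basic_setU => Fab.
    have [|Fna] := in_ultra_setVsetC (basic_set a) uF; first by left.
    by right; apply: filterS (filterI Fab Fna) => x [[]].
exists (exist _ A pA); split=> // B; rewrite nbhsE => -[C [oC Cx] CB].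
have [a [b [ax nbx abC]]] := oC _ Cx.
have [//|Fnb] := in_ultra_setVsetC (basic_set b) uF.
by apply: filterS (filterI (ax : F (basic_set a)) Fnb) => y [ay nby]; apply/CB/abC.
Qed.

Lemma basic_set_base : priestley_base (range (@basic_set L)).
Proof.
split=> [_ [a _ <-]|_ [a _ <-]|||_ _ [a _ <-] [b _ <-]|_ _ [a _ <-] [b _ <-]|x y].
- exact: basic_set_clopen.
- exact: basic_set_upset.
- by exists \bot%O => //; exact: basic_set0.
- by exists \top%O => //; exact: basic_setT.
- by exists (a `&` b)%O => //; exact: basic_setI.
- by exists (a `|` b)%O => //; exact: basic_setU.
- move=> /asboolPn/existsNP[a /not_implyP[xa nya]].
  by exists (basic_set a); split=> //; exists a.
Qed.

Lemma spectrum_priestley : priestley (spectrum L).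
Proof.
split; first exact: spectrum_compact.
move=> x y /(pb_sep basic_set_base)[U [BU Ux nUy]].
by exists U; split=> //;
  [exact: (pb_clopen basic_set_base)|exact: (pb_upset basic_set_base)].
Qed.

(** If a neighbourhood [basic_set a \ basic_set b] of [x] misses the union, then [a ∧ s <= b] for
    all [s] in [S], so [a ∧ ⋁ S <= b] by the frame law; hence [x] cannot contain [⋁ S]. *)
Lemma closure_basic_set (S : set L) :
  closure (\bigcup_(a in S) basic_set a) = basic_set (bigjoin S).
Proof.
apply/seteqP; split.
  rewrite [X in _ `<=` X](closure_id _).1; last exact: (basic_set_clopen _).2.
  apply: closureS => x [a Sa ax].
  exact: ((basic_set_le a _).2 (bigjoin_ub Sa) x ax).
move=> x xS A; rewrite nbhsE => -[B [oB Bx] BA].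
have [a [b [ax nbx abB]]] := oB _ Bx.
apply: contrapT => noy; apply: nbx.
have : basic_set (a `&` bigjoin S)%O x by rewrite basic_setI.
apply: (basic_set_le _ _).2; rewrite (pf_frame L).2.
apply: bigjoin_lub => _ [c Sc <-]; apply/basic_set_le.
rewrite basic_setI => y [ya yc]; apply: contrapT => nby.
by apply: noy; exists y; split; [exists c|apply/BA/abB].
Qed.

Lemma spectrum_sandwich (K W : set (spectrum L)) : closed K -> open W -> upset W ->
  K `<=` W -> exists2 a, K `<=` basic_set a & basic_set a `<=` W.
Proof.
move=> clK oW uW KW.
have [_ [[a _ <-] Ka aW]] :=
  priestley_sandwich spectrum_compact basic_set_base clK oW uW KW.
by exists a.
Qed.

Lemma clopup_basic (O : clopup (spectrum L)) : exists a, O = basic_clopup a.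
Proof.
have [a Oa aO] := spectrum_sandwich (@clopup_closed _ _ O) (clopup_open O)
  (@clopup_upset _ _ O) (fun _ => id).
by exists a; apply: clopup_ext; apply/seteqP; split.
Qed.

(** An open upset is the union of the basic sets inside it, so its closure is again a basic set. *)
Lemma spectrum_f_space : f_space (spectrum L).
Proof.
split=> [|W oW uW]; first exact: spectrum_priestley.
suff -> : W = \bigcup_(a in [set a | basic_set a `<=` W]) basic_set a.
  rewrite closure_basic_set.
  by split; [exact: (basic_set_clopen _).1|exact: basic_set_upset].
apply/seteqP; split=> [x Wx|x [a aW /aW]//].
have cl1 : closed [set x] := @priestley_closed1 _ _ spectrum_priestley x.
have [_ -> //|a xa aW] := spectrum_sandwich cl1 oW uW.
by exists a => //; exact: xa.
Qed.

Definition spectrum_rel x y : Prop := forall a b, a ≺ b -> sval x a -> sval y b.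

Lemma spectrum_boxE a : ~` rel_pre spectrum_rel (~` basic_set a) =
  \bigcup_(b in [set b | b ≺ a]) basic_set b.
Proof.
apply/seteqP; split=> [x nx|x [b ba xb] [y nay xy]]; last exact/nay/(xy _ _ ba).
apply: contrapT => nob; apply: nx; have fx := prime_filter (svalP x).
(* When no [b ≺ a] is in [x], the filter of all [c] with some [b ≺ c] in [x] avoids the ideal below
   [a]. A prime filter separating them is an [R]-successor of [x] that does not contain [a]. *)
have [|||A [pA FA Aa]] := @prime_filter_exists L
  [set c | exists2 b, sval x b & b ≺ c] [set c | c <= a].
- split=> /=.
  + by exists \top%O; [exact: filter_top|exact: prox_top].
  + move=> c c' [b xb bc] [b' xb' bc']; exists (b `&` b')%O.
      exact: (filter_meet fx xb xb').
    apply: (prox_meet pL).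
      by apply: (prox_trans pL _ bc (lexx _)); exact: leIl.
    by apply: (prox_trans pL _ bc' (lexx _)); exact: leIr.
  + by move=> c c' [b xb bc] cc'; exists b => //;
      exact: (prox_trans pL (lexx _) bc cc').
- split=> /=; first exact: le0x.
    by move=> c e cb eb; rewrite leUx cb.
  by move=> c e eb ce; exact: le_trans eb.
- move=> c [b xb bc] ca; apply: nob; exists b => //.
  exact: (prox_trans pL (lexx _) bc ca).
- exists (exist _ A pA); first by move=> /Aa; apply; exact: lexx.
  by move=> b c bc xb; apply: FA; exists b.
Qed.

Lemma spectrum_gleason : is_ordered_gleason spectrum_rel.
Proof.
split.
- exact: spectrum_f_space.
- rewrite /closed_rel -openC openE => -[x y] /= /existsNP[a /existsNP[b]].
  move=> /not_implyP[ab /not_implyP[xa nyb]].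
  exists (basic_set a, ~` basic_set b) => /=.
    split; apply: open_nbhs_nbhs; split=> //; first exact: (basic_set_clopen a).1.
    by rewrite openC; exact: (basic_set_clopen b).2.
  by move=> -[x' y'] [/= x'a nyb'] /(_ a b ab x'a).
- by move=> x y z t /spectrum_leP xy yz /spectrum_leP zt a b ab /xy /(yz _ _ ab) /zt.
- move=> x a b ab xa; apply: (filter_up (prime_filter (svalP x)) xa).
  exact: (prox_le pL ab).
- by move=> x y z xy yz a b /(prox_interp pL)[c ac cb] /(xy _ _ ac) /(yz _ _ cb).
- move=> O; have [a ->] := clopup_basic O.
  by rewrite /= spectrum_boxE closure_basic_set -(prox_approx pL).
Qed.

Definition spectrum_space : ordered_gleason_space :=
  OrderedGleasonSpace spectrum_gleason.

Definition clopup_basic_inv (O : clopup_pframe spectrum_space) : L :=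
  projT1 (cid (clopup_basic O)).

Lemma clopup_basic_invK : cancel clopup_basic_inv basic_clopup.
Proof. by move=> O; rewrite /clopup_basic_inv; case: cid. Qed.

Lemma basic_clopupK : cancel basic_clopup clopup_basic_inv.
Proof.
move=> a; have E : basic_set (clopup_basic_inv (basic_clopup a)) = basic_set a :=
  congr1 (@clopup_set _ _) (clopup_basic_invK (basic_clopup a)).
by apply/eqP; rewrite eq_le; apply/andP; split; apply/basic_set_le; rewrite E.
Qed.

Lemma basic_clopup_le a b :
  ((basic_clopup a : clopup_pframe spectrum_space) <= basic_clopup b) = (a <= b).
Proof.
apply/idP/idP => [/clopup_leP/basic_set_le //|ab].
by apply/clopup_leP; exact/basic_set_le. Qed.

Lemma basic_clopup_prec a b :
  a ≺ b <-> (basic_clopup a : clopup_pframe spectrum_space) ≺ basic_clopup b.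
Proof.
rewrite [X in _ <-> X]/prec /=; split=> [ab y [x xa xy]|]; first exact: (xy a b ab xa).
move=> /(@clopup_precP spectrum_space); rewrite /= spectrum_boxE => ab.
(* The compact set [basic_set a] is covered by the [basic_set c] with [c ≺ b], a family directed
   under joins, so [a <= c ≺ b] for one [c]. *)
have [||||c cb ac] := compact_directed_cover _ _ _ _ ab.
- by apply: (subclosed_compact _ spectrum_compact (@subsetT _ _));
    exact: (basic_set_clopen a).2.
- by exists \bot%O; apply: (prox_trans pL (lexx _) (prox_bot pL)); exact: le0x.
- by move=> c _; exact: (basic_set_clopen c).1.
- move=> c e cb eb; exists (c `|` e)%O; last by rewrite basic_setU.
  exact: (prox_join pL).
- by apply: (prox_trans pL _ cb (lexx _)); exact/basic_set_le.
Qed.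

Lemma basic_clopup_hom :
  is_proximity_morphism (basic_clopup : L -> clopup_pframe spectrum_space).
Proof.
exact: (order_iso_proximity_morphism basic_clopupK clopup_basic_invK
  basic_clopup_le basic_clopup_prec).
Qed.

Lemma clopup_basic_inv_hom : is_proximity_morphism clopup_basic_inv.
Proof.
apply: (order_iso_proximity_morphism clopup_basic_invK basic_clopupK) => O U.
  by rewrite -basic_clopup_le !clopup_basic_invK.
by rewrite basic_clopup_prec !clopup_basic_invK.
Qed.

End Spectrum.

Theorem theorem2p11 :
  exists OGlSp_is_category : is_category OGlSp_data,
    equivalent (category_of OGlSp_is_category) (opposite PrFrm).
Proof.
exists OGlSp_is_category.
(* Arrows are reversed in the opposite category, so the arrow from the clopen upsets of the spectrum
   to [L] is [basic_clopup], which maps out of [L]. *)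
apply: (@equivalent_of_fully_faithful _ _ clopup_functor spectrum_space rel_of_map_fhom
  (fun L => exist _ _ (@basic_clopup_hom L))
  (fun L => exist _ _ (@clopup_basic_inv_hom L))).
- exact: clopup_fhomK.
- exact: rel_of_map_fhomK.
- by move=> L; apply: eq_exist; exact/proximity_comp_cancel/clopup_basic_invK.
- by move=> L; apply: eq_exist; exact/proximity_comp_cancel/basic_clopupK.
Qed.
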